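(* Let $\bar{\mathcal O}$ be a non-degenerate conic of $\mathrm{PG}(2,q^3)$ with equation $\bar F(x,y,z)=0$, $\bar F$ a quadratic form over $\mathbb F_{q^3}$, and write $\bar F=f_0+\tau f_1+\tau^2 f_2$ (as in the context) with $f_0,f_1,f_2$ quadratic forms over $\mathbb F_q$ in $x_0,x_1,x_2,y_0,y_1,y_2,z_0,z_1,z_2$. Let $\mathcal Q_i=V(f_i)$, $i=0,1,2$, quadrics of $\mathrm{PG}(8,q)$. Then in the Bose representation: (1) in $\mathrm{PG}(8,q)$, the set of points on the planes of $[\mathcal O]$ coincides with the point set of the variety $\mathcal V([\mathcal O])=\mathcal Q_0\cap\mathcal Q_1\cap\mathcal Q_2$; (2) in $\mathrm{PG}(8,q^3)$, the point set of the variety-extension $\mathcal V([\mathcal O])^\star=\mathcal Q_0^\star\cap\mathcal Q_1^\star\cap\mathcal Q_2^\star$ coincides with the set of points on the planes $\{\langle X,Y^q,Z^{q^2}\rangle : X,Y,Z\in\mathcal O\}$; (3) in $\mathrm{PG}(8,q^6)$, the point set of the variety-extension $\mathcal V([\mathcal O])^{\bigstar}=\mathcal Q_0^{\bigstar}\cap\mathcal Q_1^{\bigstar}\cap\mathcal Q_2^{\bigstar}$ coincides with the set of points on the planes $\{\langle X,Y^q,Z^{q^2}\rangle : X,Y,Z\in\mathcal O^{\bigstar}\}$, where $\mathcal O^{\bigstar}$ is the quadratic extension of the conic $\mathcal O$ to $\Gamma^{\bigstar}\cong\mathrm{PG}(2,q^6)$.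
   Context: $q$ is a prime power; $\tau$ is a primitive element of $\mathbb F_{q^3}$ with minimal polynomial $x^3-t_2x^2-t_1x-t_0$ over $\mathbb F_q$. The forms $f_i$ arise by substituting $x=x_0+x_1\tau+x_2\tau^2$, $y=y_0+y_1\tau+y_2\tau^2$, $z=z_0+z_1\tau+z_2\tau^2$ into $\bar F$, expanding with $\tau^3=t_0+t_1\tau+t_2\tau^2$ and collecting in the basis $1,\tau,\tau^2$. Bose representation: for $\bar X=(x,y,z)\in\mathrm{PG}(2,q^3)$ and $\rho\in\mathbb F_{q^3}\setminus\{0\}$, write $\rho x=u_0+u_1\tau+u_2\tau^2$, $\rho y=v_0+v_1\tau+v_2\tau^2$, $\rho z=w_0+w_1\tau+w_2\tau^2$ and take the point $(u_0,u_1,u_2,v_0,v_1,v_2,w_0,w_1,w_2)$ of $\mathrm{PG}(8,q)$; as $\rho$ varies these form a plane $[\bar X]$; $[\mathcal O]=\{[\bar X]:\bar X\in\bar{\mathcal O}\}$. $\mathrm{PG}(8,q)\subset\mathrm{PG}(8,q^3)\subset\mathrm{PG}(8,q^6)$; $X^q$ is coordinatewise $q$-th power. $\mathsf a_0=-\tau^q\tau^{q^2}$, $\mathsf a_1=\tau^q+\tau^{q^2}$, $\mathsf a_2=-1$, $A_0=(\mathsf a_0,\mathsf a_1,\mathsf a_2,0,\dots,0)$, $A_1=(0,0,0,\mathsf a_0,\mathsf a_1,\mathsf a_2,0,0,0)$, $A_2=(0,\dots,0,\mathsf a_0,\mathsf a_1,\mathsf a_2)$, $\Gamma=\langle A_0,A_1,A_2\rangle\subset\mathrm{PG}(8,q^3)$;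 $\mathcal O=\{xA_0+yA_1+zA_2:(x,y,z)\in\bar{\mathcal O}\}\subset\Gamma$. For a variety given by equations over $\mathbb F_q$, ${}^\star$ (resp. ${}^{\bigstar}$) denotes the set of points of $\mathrm{PG}(8,q^3)$ (resp. $\mathrm{PG}(8,q^6)$) satisfying the same equations; $\Gamma^{\bigstar}$ is the plane of $\mathrm{PG}(8,q^6)$ spanned by $\Gamma$. *)

(* Defs.v *)
From HB Require Import structures.
From mathcomp Require Export all_boot all_order all_algebra all_field.
From mathcomp Require Export mpoly.

Set Implicit Arguments.
Unset Strict Implicit.
Unset Printing Implicit Defensive.

Import GRing.Theory.
Local Open Scope ring_scope.

(* A point of PG(n - 1, K) is given by homogeneous coordinates, that is, by a
   nonzero v : 'rV[K]_n up to scaling.  A set of points is given by the set of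
   all the vectors representing its points; every set of vectors below is
   closed under multiplication by nonzero scalars. *)

(* The points of V(p), for a form p. *)
Definition zero_set (K : fieldType) (n : nat) (p : {mpoly K[n]})
    (v : 'rV[K]_n) : Prop :=
  v != 0 /\ p.@[v 0] = 0.

Definition polar (K : fieldType) (n : nat) (p : {mpoly K[n]})
    (u v : 'rV[K]_n) : K :=
  p.@[(u + v) 0] - p.@[u 0] - p.@[v 0].

(* The usual characteristic-free notion: in characteristic 2 the radical of the
   polar form may be nonzero (it is, for n odd), but it contains no zero of p
   other than the zero vector. *)
Definition nondegenerate_qform (K : fieldType) (n : nat) (p : {mpoly K[n]}) :
    Prop :=
  p \is 2.-homog /\
  forall v : 'rV[K]_n, v != 0 -> (forall u, polar p u v = 0) -> p.@[v 0] != 0.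

(* The position in (u_0,u_1,u_2,v_0,v_1,v_2,w_0,w_1,w_2) of the coefficient of
   tau^k in the expansion of the j-th coordinate. *)
Definition idx (j k : 'I_3) : 'I_9 := inord (3 * j + k)%N.

Section Bose.

Variables (F : fieldType) (L : fieldExtType F) (tau : L).

(* x = x_0 + x_1 tau + x_2 tau^2, and likewise y and z, as linear forms in the
   nine variables x_0, x_1, x_2, y_0, ..., z_2. *)
Definition bose_subst : 3.-tuple {mpoly L[9]} :=
  [tuple \sum_(k < 3) tau ^+ k *: 'X_(idx j k) | j < 3].

(* The points of PG(8, q) on the plane [X], for X a point of PG(2, q^3). *)
Definition bose_plane (X : 'rV[L]_3) (P : 'rV[F]_9) : Prop :=
  P != 0 /\
  exists2 rho : L, rho != 0 &
    forall j : 'I_3, rho * X 0 j = \sum_(k < 3) (P 0 (idx j k))%:A * tau ^+ k.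

Definition on_bose_planes (O : 'rV[L]_3 -> Prop) (P : 'rV[F]_9) : Prop :=
  exists2 X : 'rV[L]_3, O X & bose_plane X P.

Variable q : nat.

Definition bose_a : seq L :=
  [:: - (tau ^+ q * tau ^+ (q ^ 2)%N); tau ^+ q + tau ^+ (q ^ 2)%N; -1].

Definition bose_A (j : 'I_3) : 'rV[L]_9 :=
  \row_(i < 9) if (i %/ 3 == j)%N then bose_a`_(i %% 3)%N else 0.

End Bose.

(* The points x A_0 + y A_1 + z A_2 with (x, y, z) on V(p). *)
Definition spanned_conic (K : fieldType) (A : 'I_3 -> 'rV[K]_9)
    (p : {mpoly K[3]}) (X : 'rV[K]_9) : Prop :=
  exists2 v : 'rV[K]_3, zero_set p v & X = \sum_(j < 3) v 0 j *: A j.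

(* X^m, coordinatewise. *)
Definition vpow (K : fieldType) (n m : nat) (X : 'rV[K]_n) : 'rV[K]_n :=
  map_mx (fun x => x ^+ m) X.

(* The points on the planes < X, Y^q, Z^(q^2) > with X, Y, Z in O; rank 3 says
   that the span is indeed a plane. *)
Definition on_conjugate_planes (K : fieldType) (n q : nat)
    (O : 'rV[K]_n -> Prop) (P : 'rV[K]_n) : Prop :=
  P != 0 /\
  exists X Y Z : 'rV[K]_n,
    let U := (X + vpow q Y + vpow (q ^ 2)%N Z)%MS in
    [/\ O X, O Y, O Z, \rank U = 3%N & (P <= U)%MS].

(* Main.v *)
(* Let l_i(P)_j = sum_k P_jk (tau^(q^i))^k.  Conjugating the identity that
   defines f_0, f_1, f_2 gives
     Fbar^(q^i)(l_i(P)) = f_0(P) + tau^(q^i) f_1(P) + tau^(2 q^i) f_2(P),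
   for i = 0, 1, 2, and by Vandermonde the f_e all vanish at P if and only if
   these three conjugate forms vanish at l_0(P), l_1(P), l_2(P).  The points
   A_j^(q^i) form, up to nonzero factors, the basis dual to the l_i, so that
   the l_i(P) are the coordinates of the components of P in Gamma, Gamma^q and
   Gamma^(q^2).  A component that is zero imposes nothing on its conic point:
   any point of the conic will do, and the Chevalley-Warning theorem provides
   one. *)
From HB Require Import structures.
From mathcomp Require Import all_fingroup cyclic ring zify.
Require Import Defs.

Set Implicit Arguments.
Unset Strict Implicit.
Unset Printing Implicit Defensive.

Import GRing.Theory.
Local Open Scope ring_scope.

(** * Zeros of a form of degree less than its number of variables over a finite field *)

Lemma natr_card_finField (K : finFieldType) : #|K|%:R = 0 :> K.
Proof. by rewrite -cardsT -[RHS](expg_cardG (in_setT (1 : K))). Qed.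

(** For k > 0, 'X^k - 1 has at most k roots, so some nonzero [g] has [g ^+ k != 1]; reindexing by x
    -> g x multiplies the sum by [g ^+ k], which forces it to be 0. For k = 0 the sum is [#|K|], as
    0^0 counts as 1. *)
Lemma sum_expr_finField (K : finFieldType) (k : nat) :
  (k < #|K|.-1)%N -> \sum_(x : K) x ^+ k = 0.
Proof.
case: k => [_|k lt_k].
  rewrite (eq_bigr (fun=> 1)) => [|x _]; last by rewrite expr0.
  by rewrite sumr_const natr_card_finField.
have [g nzg gk] : exists2 g : K, g != 0 & g ^+ k.+1 != 1.
  pose rs := enum (predC1 (0 : K)).
  have [/allP urs|/allPn[x]] := boolP (all (k.+1).-unity_root rs).
    have:= max_unity_roots (ltn0Sn k) (introT allP urs) (enum_uniq _).
    by rewrite -cardE cardC1 leqNgt lt_k.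
  by rewrite mem_enum unity_rootE => ?; exists x.
have: \sum_(x : K) x ^+ k.+1 = g ^+ k.+1 * \sum_(x : K) x ^+ k.+1.
  rewrite [LHS](reindex_inj (mulfI nzg)) mulr_sumr.
  by apply: eq_bigr => x _; rewrite exprMn.
move/eqP; rewrite -subr_eq0 -{1}[\sum_(_ : K) _]mul1r -mulrBl mulf_eq0 subr_eq0.
by rewrite eq_sym (negbTE gk) => /eqP.
Qed.

Lemma chevalley_warning (K : finFieldType) (n d : nat) (p : {mpoly K[n]}) :
  p \is d.-homog -> (0 < d < n)%N -> exists v, zero_set p v.
Proof.
move=> homp /andP[d_gt0 lt_dn].
have Q1 : (0 < #|K|.-1)%N by rewrite -subn1 subn_gt0 finNzRing_gt1.
have p0 : p.@[(0 : 'rV_n) 0] = 0.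
  rewrite mevalE big1_seq // => m /andP[_ /(dhomogP _ _ _ homp) dm].
  have {}dm : mdeg m = d := dm.
  have [i mi] : exists i, m i != 0%N.
    apply/existsP; rewrite -negb_forall; apply: contraL d_gt0 => /forallP m0.
    by rewrite -dm mdegE big1 // => i _; apply/eqP.
  by rewrite (bigD1 i) //= mxE expr0n (negbTE mi) mul0r mulr0.
have sum0 (r : {mpoly K[n]}) : r \is (d * #|K|.-1).-homog ->
    \sum_(v : 'rV[K]_n) r.@[v 0] = 0.
  move=> homr; under eq_bigr do rewrite mevalE.
  rewrite exchange_big big1_seq // => m /andP[_ /(dhomogP _ _ _ homr) dm].
  have {}dm : mdeg m = (d * #|K|.-1)%N := dm.
  rewrite -mulr_sumr.
  (* If every exponent were at least [#|K|.-1], the degree would be at least n (#|K| - 1), against d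
     < n. *)
  have [i mi] : exists i, (m i < #|K|.-1)%N.
    apply/existsP; apply: contraLR lt_dn.
    rewrite negb_exists -leqNgt => /forallP mge.
    rewrite -(leq_pmul2r Q1) -dm mdegE -{1}[n]card_ord -sum_nat_const.
    by apply: leq_sum => i _; rewrite leqNgt.
  (* Vectors become functions so that the sum of products factors as a product of one-variable power
     sums; the factor at [i] is 0. *)
  rewrite (reindex (fun f : {ffun 'I_n -> K} => \row_i f i)) /=; last first.
    exists (fun v : 'rV_n => [ffun i => v 0 i]) => f _.
      by apply/ffunP=> j; rewrite ffunE mxE.
    by apply/rowP=> j; rewrite mxE ffunE.
  rewrite (eq_bigr (fun f : {ffun 'I_n -> K} => \prod_j f j ^+ m j)) /=;
      last first.
    by move=> f _; apply: eq_bigr => j _; rewrite mxE.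
  rewrite -(bigA_distr_bigA (fun j x => x ^+ m j)) (bigD1 i) //=.
  by rewrite sum_expr_finField // mul0r mulr0.
have [/existsP[v /andP[nzv /eqP pv]]|] :=
  boolP [exists v : 'rV[K]_n, (v != 0) && (p.@[v 0] == 0)]; first by exists v.
rewrite negb_exists => /forallP nopt.
have/eqP[] := oner_neq0 K.
(* If 0 were the only zero, 1 - p^(#|K| - 1) would be its indicator function. *)
transitivity (\sum_(v : 'rV[K]_n) (1 - p.@[v 0] ^+ #|K|.-1)).
  rewrite (bigD1 0) //= p0 expr0n eqn0Ngt Q1 subr0 big1 ?addr0 // => v nzv.
  have := nopt v; rewrite nzv /= => /eqP pv; apply/eqP.
  rewrite subr_eq0 eq_sym; apply/eqP/(mulfI (introN eqP pv)).
  by rewrite -exprS prednK ?expf_card ?mulr1 // ltnW ?finNzRing_gt1.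
rewrite sumrB; under [X in _ - X]eq_bigr do rewrite -rmorphXn /=.
rewrite sum0 ?dhomogMn // subr0 sumr_const card_mx mul1n.
(* The constant 1 sums to #|K|^n, which is 0 in K because n > 0. *)
by rewrite -(ltn_predK lt_dn) expnS natrM natr_card_finField mul0r.
Qed.

(** * Frobenius powers as ring morphisms *)

Lemma card_pchar_nat (K : finFieldType) : [pchar K].-nat #|K|.
Proof.
have [p pr_p chp] := finPcharP K.
have -> : #|K| = (p ^ logn p #|K|)%N := card_pprimeChar chp.
by rewrite pnatX (eq_pnat _ (pcharf_eq chp)) pnat_id.
Qed.

(** The proof that [n] is a [[pchar K]]-number is an argument so that the ring morphism structure
    below can be attached to the map. *)
Definition frob (K : fieldType) (n : nat) of [pchar K].-nat n :=
  fun x : K => x ^+ n.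

Section Frobenius.

Variables (K : fieldType) (n : nat) (pchar_n : [pchar K].-nat n).

Lemma frob_is_nmod_morphism : nmod_morphism (frob pchar_n).
Proof.
split=> [|x y]; last exact: exprDn_pchar.
by apply/eqP; rewrite /frob expf_eq0 eqxx andbT; case/andP: pchar_n.
Qed.

Lemma frob_is_monoid_morphism : monoid_morphism (frob pchar_n).
Proof. by split=> [|x y]; rewrite /frob ?expr1n ?exprMn. Qed.

HB.instance Definition _ :=
  GRing.isNmodMorphism.Build K K (frob pchar_n) frob_is_nmod_morphism.
HB.instance Definition _ :=
  GRing.isMonoidMorphism.Build K K (frob pchar_n) frob_is_monoid_morphism.

End Frobenius.

(** * Evaluation of polynomials along field morphisms *)

Section MmapField.

Variables (R S : fieldType) (f : {rmorphism R -> S}).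

Lemma mmap_map_mpoly (T : fieldType) (g : {rmorphism S -> T}) (n : nat)
    (p : {mpoly R[n]}) (v : 'I_n -> T) :
  mmap g v (map_mpoly f p) = mmap (g \o f) v p.
Proof.
rewrite /mmap (perm_big _ (msupp_map_mpoly _ (fmorph_inj f))) /=.
by apply: eq_bigr => m _; rewrite mcoeff_map_mpoly.
Qed.

Lemma meval_map_mpoly (n : nat) (p : {mpoly R[n]}) (v : 'I_n -> S) :
  (map_mpoly f p).@[v] = mmap f v p.
Proof. exact: (mmap_map_mpoly idfun). Qed.

Lemma mmap_comp_mpoly (n k : nat) (lq : n.-tuple {mpoly R[k]})
    (p : {mpoly R[n]}) (v : 'I_k -> S) :
  mmap f v (p \mPo lq) = mmap f (fun i => mmap f v (tnth lq i)) p.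
Proof.
rewrite comp_mpolyE rmorph_sum; apply: eq_bigr => m _ /=.
rewrite mmapZ rmorph_prod; congr (_ * _).
by apply: eq_bigr => i _; rewrite rmorphXn.
Qed.

Lemma rmorph_mmap (T : fieldType) (g : {rmorphism S -> T}) (n : nat)
    (p : {mpoly R[n]}) (v : 'I_n -> S) :
  mmap (g \o f) (g \o v) p = g (mmap f v p).
Proof.
rewrite rmorph_sum; apply: eq_bigr => m _; rewrite rmorphM rmorph_prod.
by congr (_ * _); apply: eq_bigr => i _; rewrite rmorphXn.
Qed.

Lemma eq_mmap (g : R -> S) (n : nat) (p : {mpoly R[n]}) (u v : 'I_n -> S) :
  f =1 g -> u =1 v -> mmap f u p = mmap g v p.
Proof.
by move=> fg uv; apply: eq_bigr => m _; rewrite fg (mmap1_eq _ uv).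
Qed.

Lemma mmap_dhomog (n d : nat) (p : {mpoly R[n]}) (c : S) (v : 'I_n -> S) :
  p \is d.-homog -> mmap f (fun i => c * v i) p = c ^+ d * mmap f v p.
Proof.
move=> /dhomogP homp; rewrite /mmap mulr_sumr !big_seq.
apply: eq_bigr => m /homp dm.
have {}dm : mdeg m = d := dm.
rewrite mulrCA; congr (_ * _); rewrite -dm mdegE expr_sum -big_split /=.
by apply: eq_bigr => i _; rewrite exprMn.
Qed.

End MmapField.

(** * Vandermonde, and the indexing of the nine coordinates *)

Lemma sum_expr_eq0 (K : fieldType) (n : nat) (t a : 'I_n -> K) :
  injective t -> (forall i, \sum_k a k * t i ^+ k = 0) -> forall k, a k = 0.
Proof.
(* A polynomial of size at most n with n distinct roots is 0. [b] extends [a] to all naturals, as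
   [\poly] requires; the default 0 is never read below n. *)
move=> inj_t a_t k; pose b j := if insub j is Some i then a i else 0.
have bE (i : 'I_n) : b i = a i by rewrite /b valK.
have /(congr1 (fun p : {poly K} => p`_k)) : \poly_(j < n) b j = 0.
  apply: (@roots_geq_poly_eq0 _ _ (codom t)).
  - apply/allP=> _ /codomP[i ->]; rewrite rootE horner_poly; apply/eqP.
    by rewrite -[RHS](a_t i); apply: eq_bigr => j _; rewrite bE.
  - by rewrite map_inj_uniq ?enum_uniq.
  - by rewrite size_codom card_ord size_poly.
by rewrite coef_poly coef0 ltn_ord bE.
Qed.

Lemma idx_val (j k : 'I_3) : idx j k = (3 * j + k)%N :> nat.
Proof.
by rewrite inordK //; move: j k => [[|[|[|//]]] ?] [[|[|[|//]]] ?].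
Qed.

Lemma idx_surj (i : 'I_9) : exists j k, i = idx j k.
Proof.
have lt_q : (i %/ 3 < 3)%N by rewrite ltn_divLR.
exists (Ordinal lt_q), (Ordinal (ltn_pmod i (isT : (0 < 3)%N))).
by apply: ord_inj; rewrite idx_val /= mulnC -divn_eq.
Qed.

Lemma bose_A_idx (F : fieldType) (L : fieldExtType F) (tau : L) q j j' k :
  bose_A tau q j 0 (idx j' k) = if j' == j then (bose_a tau q)`_k else 0.
Proof.
by rewrite mxE idx_val mulnC divnMDl // divn_small // addn0 modnMDl modn_small.
Qed.

(** Turns the span of three points into a row space, so that [inj_row_free] gives its rank and
    [submxP] its points. *)
Lemma adds3_matrix (K : fieldType) (n : nat) (W : 'I_3 -> 'rV[K]_n) :
  (W 0%R + W 1%R + W 2%R :=: \matrix_i W i)%MS.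
Proof.
have sub (i : 'I_3) : (W i <= \matrix_i W i)%MS.
  by have := row_sub i (\matrix_i W i); rewrite rowK.
apply/eqmxP; rewrite !addsmx_sub !sub /=; apply/row_subP => i; rewrite rowK.
have [->|->|->] : [\/ i = 0, i = 1 | i = 2].
- by case: i => [[|[|[|//]]] ?];
    [constructor 1 | constructor 2 | constructor 3]; apply: val_inj.
- exact: submx_trans (addsmxSl _ _) (addsmxSl _ _).
- exact: submx_trans (addsmxSr _ _) (addsmxSl _ _).
- exact: addsmxSr.
Qed.

(** * Conjugate coordinates and conjugate planes over an extension K of L *)

Section BoseConic.

Variables (F : fieldType) (L : fieldExtType F) (tau : L) (q : nat).
Variables (Fbar : {mpoly L[3]}) (f : 'I_3 -> {mpoly F[9]}).

Hypothesis pchar_q : [pchar F].-nat q.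
Hypothesis expF : forall a : F, a ^+ q = a.
Hypothesis tau_q3 : tau ^+ (q ^ 3) = tau.
Hypothesis tau_inj : injective (fun i : 'I_3 => tau ^+ (q ^ i)).
Hypothesis hf : Fbar \mPo bose_subst tau
  = \sum_(e < 3) tau ^+ e *: map_mpoly (in_alg L) (f e).

Variables (K : fieldType) (phi : {rmorphism L -> K}).

Lemma pchar_qX (i : 'I_3) : [pchar K].-nat (q ^ i)%N.
Proof.
rewrite pnatX (eq_pnat _ (fmorph_pchar phi)).
by rewrite (eq_pnat _ (fmorph_pchar (in_alg L))) pchar_q.
Qed.

Definition conj_emb (i : 'I_3) : {rmorphism L -> K} :=
  frob (pchar_qX i) \o phi.

Lemma conj_embE i x : conj_emb i x = phi x ^+ (q ^ i).
Proof. by []. Qed.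

(** Conjugation fixes the image of F, so the forms f_e, unlike Fbar, are unchanged by it. *)
Lemma conj_emb_base i a : conj_emb i a%:A = phi a%:A.
Proof.
rewrite conj_embE -[a%:A]/(in_alg L a) -!rmorphXn; congr (phi (in_alg L _)).
by elim: (nat_of_ord i) => [|n IHn]; rewrite ?expr1 // expnS exprM expF.
Qed.

Lemma conj_tau_inj : injective (conj_emb^~ tau).
Proof.
by move=> i i'; rewrite !conj_embE -!rmorphXn => /fmorph_inj/tau_inj.
Qed.

(** These are the linear forms l_i(P)_j. *)
Definition conj_coord (i : 'I_3) (P : 'rV[K]_9) (j : 'I_3) : K :=
  \sum_(k < 3) P 0 (idx j k) * conj_emb i tau ^+ k.

Lemma conj_coord_sum i j (I : finType) (a : I -> K) (P : I -> 'rV[K]_9) :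
  conj_coord i (\sum_m a m *: P m) j = \sum_m a m * conj_coord i (P m) j.
Proof.
rewrite /conj_coord; under [RHS]eq_bigr do rewrite mulr_sumr.
rewrite exchange_big; apply: eq_bigr => k _ /=.
rewrite summxE mulr_suml; apply: eq_bigr => m _.
by rewrite mxE mulrA.
Qed.

(** For each j, the three forms l_i(P)_j are a Vandermonde system in P_j0, P_j1, P_j2 with the
    distinct nodes [conj_emb i tau]. *)
Lemma conj_coord_inj (P Q : 'rV[K]_9) :
  (forall i j, conj_coord i P j = conj_coord i Q j) -> P = Q.
Proof.
move=> PQ; apply/rowP=> m; have [j [k ->]] := idx_surj m; apply/eqP.
rewrite -subr_eq0; apply/eqP; apply: (sum_expr_eq0 conj_tau_inj
  (a := fun k => P 0 (idx j k) - Q 0 (idx j k))) => i.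
by under eq_bigr do rewrite mulrBl; rewrite sumrB [X in X - _](PQ i j) subrr.
Qed.

Lemma mmap_conj_coord i (P : 'rV[K]_9) :
  mmap (conj_emb i) (conj_coord i P) Fbar
  = \sum_(e < 3) mmap (phi \o in_alg L) (P 0) (f e) * conj_emb i tau ^+ e.
Proof.
have /(congr1 (mmap (conj_emb i) (P 0))) := hf.
rewrite mmap_comp_mpoly raddf_sum /= => hP.
transitivity (mmap (conj_emb i) (fun j : 'I_3 =>
    mmap (conj_emb i) (P 0) (tnth (bose_subst tau) j)) Fbar).
  apply: eq_mmap => // j; rewrite tnth_mktuple raddf_sum /=.
  by apply: eq_bigr => k _; rewrite mmapZ mmapX mmap1U mulrC rmorphXn.
rewrite hP; apply: eq_bigr => e _; rewrite mmapZ mulrC rmorphXn.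
congr (_ * _); rewrite mmap_map_mpoly; apply: eq_mmap => // a.
exact: conj_emb_base.
Qed.

Lemma forms_eq0P (P : 'rV[K]_9) :
  (forall e, mmap (phi \o in_alg L) (P 0) (f e) = 0)
  <-> (forall i, mmap (conj_emb i) (conj_coord i P) Fbar = 0).
Proof.
split=> [f0 i | F0 e].
  by rewrite mmap_conj_coord big1 // => e _; rewrite f0 mul0r.
pose a e := mmap (phi \o in_alg L) (P 0) (f e).
by apply: (sum_expr_eq0 conj_tau_inj (a := a)) => i; rewrite -mmap_conj_coord.
Qed.

Lemma mmap_conj_pow i (v : 'I_3 -> K) :
  mmap (conj_emb i) (fun j => v j ^+ (q ^ i)) Fbar
  = mmap phi v Fbar ^+ (q ^ i).
Proof. exact: (rmorph_mmap phi (frob (pchar_qX i))). Qed.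

Let A (i j : 'I_3) : 'rV[K]_9 := vpow (q ^ i) (map_mx phi (bose_A tau q j)).

(* With a_0 + a_1 T + a_2 T^2 = - (T - tau^q) (T - tau^(q^2)), this is the
   value at tau^(q^i') of the q^i-conjugate of this polynomial. *)
Let c (i i' : 'I_3) : K :=
  \sum_(k < 3) conj_emb i (bose_a tau q)`_k * conj_emb i' tau ^+ k.

(** The roots of the q^i-conjugate polynomial are the conjugates of tau with indices i + 1 and i + 2
    modulo 3, so the only conjugate that is not a root is the one of index i. *)
Lemma bose_c_eq0 i i' : (c i i' == 0) = (i != i').
Proof.
pose s n := phi tau ^+ (q ^ n).
have s3 n : s (n + 3)%N = s n.
  by rewrite /s addnC expnD exprM -[phi tau ^+ _]rmorphXn tau_q3.
have sE n : conj_emb i (tau ^+ (q ^ n)) = s (i + n)%N.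
  by rewrite conj_embE rmorphXn -exprM mulnC -expnD addnC.
have -> : c i i' = - ((s i' - s (i + 1)%N) * (s i' - s (i + 2)%N)).
  (* The exponent q is restated as q^1 so that [sE] applies to each coefficient of the
     polynomial. *)
  rewrite -!sE; transitivity (
    conj_emb i (- (tau ^+ (q ^ 1)%N * tau ^+ (q ^ 2)%N)) * s i' ^+ 0
    + (conj_emb i (tau ^+ (q ^ 1)%N + tau ^+ (q ^ 2)%N) * s i' ^+ 1
       + (conj_emb i (-1) * s i' ^+ 2 + 0))).
    by rewrite /c !big_ord_recl big_ord0.
  rewrite rmorphN rmorphM rmorphD rmorphN1 !sE.
  ring.
have s_inj (m n : 'I_3) : (s m == s n) = (m == n).
  apply/eqP/eqP => [|->//]; exact: (@conj_tau_inj m n).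
(* Periodicity brings i + 1 and i + 2 back into 'I_3, where [s] is injective; nine index pairs then
   remain to be checked. *)
have sS (m : nat) : s m = s (inord (m %% 3) : 'I_3).
  rewrite {1}(divn_eq m 3) inordK ?ltn_pmod // addnC.
  by elim: (m %/ 3)%N => [|d IHd]; rewrite ?addn0 // mulSnr addnA s3.
rewrite oppr_eq0 mulf_eq0 !subr_eq0 (sS (i + 1)%N) (sS (i + 2)%N) !s_inj.
rewrite -!val_eqE /= !inordK ?ltn_pmod //.
by move: i i' {sE} => [[|[|[|//]]] ?] [[|[|[|//]]] ?].
Qed.

Lemma conj_coord_bose i i' j j' :
  conj_coord i' (A i j) j' = if j' == j then c i i' else 0.
Proof.
have AE k : A i j 0 (idx j' k)
    = if j' == j then conj_emb i (bose_a tau q)`_k else 0.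
  rewrite /A 2!mxE bose_A_idx; case: ifP => // _; exact: rmorph0 (conj_emb i).
transitivity (\sum_(k < 3) (if j' == j then conj_emb i (bose_a tau q)`_k else 0)
                    * conj_emb i' tau ^+ k).
  by apply: eq_bigr => k _; rewrite AE.
by case: ifP => // _; rewrite big1 // => k _; rewrite mul0r.
Qed.

Hypothesis homF : Fbar \is 2.-homog.
Hypothesis root_q : forall (i : 'I_3) (y : K), exists x, x ^+ (q ^ i) = y.
Hypothesis conic_point : exists v : 'rV[K]_3, zero_set (map_mpoly phi Fbar) v.

(* The point of Gamma^(q^i) with coordinates x^(q^i). *)
Let V (i : 'I_3) (x : 'rV[K]_3) := \sum_j x 0 j ^+ (q ^ i) *: A i j.

Lemma vpow_spanned (i : 'I_3) (x : 'rV[K]_3) :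
  vpow (q ^ i) (\sum_j x 0 j *: map_mx phi (bose_A tau q j)) = V i x.
Proof.
apply/rowP=> m; rewrite mxE !summxE.
rewrite -[LHS]/(frob (pchar_qX i) _) rmorph_sum; apply: eq_bigr => j _.
by rewrite !mxE /= [LHS]exprMn.
Qed.

Lemma conj_coord_point (i i' : 'I_3) x j :
  conj_coord i' (V i x) j = c i i' * x 0 j ^+ (q ^ i).
Proof.
rewrite conj_coord_sum (bigD1 j) //= conj_coord_bose eqxx.
rewrite big1 ?addr0 1?mulrC //.
by move=> k /negbTE kj; rewrite conj_coord_bose eq_sym kj mulr0.
Qed.

Lemma conj_coord_comb (d : 'I_3 -> K) (x : 'I_3 -> 'rV[K]_3) i j :
  conj_coord i (\sum_m d m *: V m (x m)) j = d i * (c i i * x i 0 j ^+ (q ^ i)).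
Proof.
rewrite conj_coord_sum (bigD1 i) //= conj_coord_point big1 ?addr0 // => m mi.
by rewrite conj_coord_point (eqP (_ : c m i == 0)) ?bose_c_eq0 // mul0r mulr0.
Qed.

(** The forms l_i annihilate Gamma^(q^m) for m != i, so applying l_i to a vanishing combination
    isolates its i-th coefficient, times a nonzero constant and a nonzero coordinate of [x i]. *)
Lemma rank_conj_points (x : 'I_3 -> 'rV[K]_3) : (forall i, x i != 0) ->
  \rank (\matrix_i V i (x i)) = 3%N.
Proof.
move=> nzx; apply/eqP/inj_row_free => d; rewrite mulmx_sum_row.
under eq_bigr do rewrite rowK.
move=> d0; apply/rowP=> i; rewrite mxE.
have [j nzj] : exists j, x i 0 j != 0 by apply/rV0Pn.
have := conj_coord_comb (d 0) x i j; rewrite d0.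
rewrite /conj_coord big1 => [/esym/eqP|k _]; last by rewrite mxE mul0r.
rewrite mulf_eq0 => /orP[/eqP //|]; rewrite mulf_eq0 bose_c_eq0 eqxx /=.
by rewrite expf_eq0 (negbTE nzj) andbF.
Qed.

Variable A' : 'I_3 -> 'rV[K]_9.
Hypothesis hA' : forall j, A' j = map_mx phi (bose_A tau q j).
Let conic := spanned_conic A' (map_mpoly phi Fbar).

(** Replaces the geometric planes by explicit combinations; the rank clause is supplied by
    [rank_conj_points]. *)
Lemma conj_planesP (P : 'rV[K]_9) :
  on_conjugate_planes q conic P <->
  P != 0 /\ exists2 x : 'I_3 -> 'rV[K]_3,
    forall i, zero_set (map_mpoly phi Fbar) (x i)
    & exists d : 'I_3 -> K, P = \sum_i d i *: V i (x i).
Proof.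
have powV (i : 'I_3) (x : 'rV[K]_3) :
    vpow (q ^ i) (\sum_j x 0 j *: A' j) = V i x.
  by rewrite -vpow_spanned; under eq_bigr do rewrite hA'.
have pow0 (x : 'rV[K]_3) : \sum_j x 0 j *: A' j = V 0 x.
  by rewrite -powV; apply/rowP=> m; rewrite [RHS]mxE expr1.
split=> -[nzP]; last first.
  case=> x Fx [d defP]; split=> //.
  exists (\sum_j x 0 0 j *: A' j), (\sum_j x 1 0 j *: A' j),
    (\sum_j x 2 0 j *: A' j).
  have UE := adds3_matrix (fun i => V i (x i)).
  rewrite pow0 (powV 1) (powV 2) /=.
  split; [exists (x 0) | exists (x 1) | exists (x 2) | | ] => //.
    by rewrite UE rank_conj_points // => i; case: (Fx i).
  rewrite UE; apply/submxP; exists (\row_i d i); rewrite mulmx_sum_row defP.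
  by apply: eq_bigr => i _; rewrite mxE rowK.
case=> X [Y [Z]] /= [[x Fx ->] [y Fy ->] [z Fz ->] _].
rewrite pow0 (powV 1) (powV 2); pose w (i : 'I_3) := [:: x; y; z]`_i.
rewrite (adds3_matrix (fun i => V i (w i))) => /submxP[D defP]; split=> //.
exists w; first by case=> [[|[|[|//]]] ?].
exists (D 0); rewrite defP mulmx_sum_row; apply: eq_bigr => i _.
by rewrite rowK.
Qed.

Lemma forms_zeroP (P : 'rV[K]_9) :
  (P != 0 /\ forall e, mmap (phi \o in_alg L) (P 0) (f e) = 0)
  <-> on_conjugate_planes q conic P.
Proof.
rewrite conj_planesP; split=> -[nzP]; last first.
  case=> x Fx [d defP]; split=> //; apply/forms_eq0P => i.
  have [_] := Fx i; rewrite meval_map_mpoly => Fxi.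
  transitivity (mmap (conj_emb i)
      (fun j => (d i * c i i) * x i 0 j ^+ (q ^ i)) Fbar).
    by apply: eq_mmap => // j; rewrite defP conj_coord_comb mulrA.
  (* Homogeneity extracts the scalar, and what remains is the q^i-th power of the value of Fbar at a
     conic point. *)
  rewrite (mmap_dhomog _ _ _ homF) mmap_conj_pow Fxi.
  by rewrite -[_ ^+ (q ^ i)]/(frob (pchar_qX i) 0) rmorph0 mulr0.
move/forms_eq0P => F0; split=> //; have [v0 Fv0] := conic_point.
have hx (i : 'I_3) : exists2 x : 'rV[K]_3, zero_set (map_mpoly phi Fbar) x
    & exists d, forall j, conj_coord i P j = d * x 0 j ^+ (q ^ i).
  have [j nzj | P0] := pickP (fun j => conj_coord i P j != 0); last first.
    exists v0 => //; exists 0 => j; rewrite mul0r.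
    by apply/eqP; rewrite -[_ == _]negbK P0.
  (* V raises coordinates to the power q^i, so the conic point is found by taking q^i-th roots of
     the coordinates l_i(P). *)
  have [x xE] := fin_all_exists (fun j' => root_q i (conj_coord i P j')).
  exists (\row_j' x j'); last by exists 1 => j'; rewrite mul1r mxE xE.
  split.
    apply: contraNneq nzj => /rowP/(_ j); rewrite !mxE -xE => ->.
    by rewrite -[_ ^+ _]/(frob (pchar_qX i) 0) rmorph0.
  have /eqP : mmap phi x Fbar ^+ (q ^ i) = 0.
    by rewrite -mmap_conj_pow -[RHS](F0 i); apply: eq_mmap.
  rewrite expf_eq0 => /andP[_ /eqP Fx]; rewrite meval_map_mpoly -[RHS]Fx.
  by apply: eq_mmap => // j'; rewrite mxE.
have [x Fx /fin_all_exists[d dE]] := fin_all_exists2 hx.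
(* Dividing by [c i i] cancels the factor that l_i produces on Gamma^(q^i). *)
exists x => //; exists (fun i => d i / c i i).
apply: conj_coord_inj => i j; rewrite conj_coord_comb dE mulrA divfK //.
by rewrite bose_c_eq0 eqxx.
Qed.

End BoseConic.

(** * Finite field facts for L and M *)

Lemma expf_card_ext (F : finFieldType) (L : fieldExtType F) (x : L) :
  x ^+ (#|F| ^ \dim {:L})%N = x.
Proof.
have <- : #|finvect_type L| = (#|F| ^ \dim {:L})%N.
  have := @card_vspace F (finvect_type L) _ (fullv : {vspace finvect_type L}).
  by rewrite card_vspacef.
exact: (expf_card (x : finvect_type L)).
Qed.

Lemma zero_set_ternary_ext (F : finFieldType) (L : fieldExtType F)
    (p : {mpoly L[3]}) :
  p \is 2.-homog -> exists v, zero_set p v.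
Proof.
move=> homp.
exact: (@chevalley_warning (finvect_type L) 3 2 p homp isT).
Qed.

Lemma zero_set_map (K K' : fieldType) (g : {rmorphism K -> K'}) (n : nat)
    (p : {mpoly K[n]}) (v : 'rV[K]_n) :
  zero_set p v -> zero_set (map_mpoly g p) (map_mx g v).
Proof.
case=> nzv pv; split; first by rewrite map_mx_eq0.
rewrite meval_map_mpoly -[RHS](rmorph0 g) -[in RHS]pv.
rewrite -(rmorph_mmap idfun g); apply: eq_mmap => // j.
by rewrite mxE.
Qed.

(** The exponents 1, q, q^2 are distinct and less than the order q^3 - 1 of tau. *)
Lemma tau_pow_inj (L : fieldType) (tau : L) (q : nat) : (1 < q)%N ->
  (q ^ 3 - 1)%N.-primitive_root tau ->
  injective (fun i : 'I_3 => tau ^+ (q ^ i)).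
Proof.
move=> q_gt1 htau i j /= /eqP; rewrite (eq_prim_root_expr htau).
have lt_q (m : 'I_3) : (q ^ m < q ^ 3 - 1)%N.
  have : (q ^ m <= q ^ 2)%N by rewrite leq_pexp2l ?(ltnW q_gt1) // -ltnS.
  nia.
rewrite !modn_small // => /eqP/(expnI q_gt1) ij.
exact: val_inj.
Qed.

Section BosePlanes.

Variables (F : fieldType) (L : fieldExtType F) (tau : L) (q : nat).
Variables (Fbar : {mpoly L[3]}) (f : 'I_3 -> {mpoly F[9]}).

Hypothesis pchar_q : [pchar F].-nat q.
Hypothesis expF : forall a : F, a ^+ q = a.
Hypothesis tau_inj : injective (fun i : 'I_3 => tau ^+ (q ^ i)).
Hypothesis hf : Fbar \mPo bose_subst tau
  = \sum_(e < 3) tau ^+ e *: map_mpoly (in_alg L) (f e).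
Hypothesis homF : Fbar \is 2.-homog.

(** For P over F, the coordinates l_i(P) are the conjugates of x = l_0(P), so the three conjugate
    conditions collapse to Fbar(x) = 0, and x is the point of PG(2, q^3) whose Bose plane contains
    P. *)
Lemma bose_planesP (P : 'rV[F]_9) :
  on_bose_planes tau (zero_set Fbar) P
  <-> P != 0 /\ forall e, (f e).@[P 0] = 0.
Proof.
pose PL := map_mx (in_alg L) P.
pose x j := conj_coord tau pchar_q idfun 0 PL j.
have xE j : x j = \sum_(k < 3) (P 0 (idx j k))%:A * tau ^+ k.
  by apply: eq_bigr => k _; rewrite mxE conj_embE expr1.
have conj_x (i j : 'I_3) : conj_coord tau pchar_q idfun i PL j = x j ^+ (q ^ i).
  rewrite -[RHS]/(conj_emb pchar_q idfun i _) xE rmorph_sum.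
  by apply: eq_bigr => k _; rewrite mxE rmorphM (conj_emb_base _ expF) rmorphXn.
have fP : (forall e, (f e).@[P 0] = 0) <-> Fbar.@[x] = 0.
  transitivity (forall e, mmap (idfun \o in_alg L) (PL 0) (f e) = 0).
    have fE e : mmap (idfun \o in_alg L) (PL 0) (f e) = in_alg L (f e).@[P 0].
      rewrite -(rmorph_mmap idfun (in_alg L)).
      by apply: eq_mmap => // j; rewrite mxE.
    split=> f0 e; first by rewrite fE f0 rmorph0.
    by have /esym/eqP := fE e; rewrite f0 fmorph_eq0 => /eqP.
  rewrite (forms_eq0P pchar_q expF tau_inj hf idfun).
  have FE i : mmap (conj_emb pchar_q idfun i)
        (conj_coord tau pchar_q idfun i PL) Fbar
      = Fbar.@[x] ^+ (q ^ i).
    rewrite -[Fbar.@[x]]/(mmap idfun x Fbar) -(mmap_conj_pow _ pchar_q).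
    exact: eq_mmap.
  split=> [/(_ 0)|F0 i]; first by rewrite FE expr1.
  by rewrite FE F0 -[LHS]/(conj_emb pchar_q idfun i 0) rmorph0.
rewrite fP; split=> [[X [nzX FX] [nzP [rho nzr Xx]]] | [nzP Fx]].
  split=> //; rewrite (@meval_eq _ _ _ (fun j => rho * X 0 j)) => [|j].
    by rewrite [LHS](mmap_dhomog idfun _ _ homF) [mmap _ _ _]FX mulr0.
  by rewrite xE Xx.
exists (\row_j x j); last first.
  by split=> //; exists 1; rewrite ?oner_neq0 // => j; rewrite mul1r mxE xE.
split; last by rewrite -[RHS]Fx; apply: meval_eq => j; rewrite mxE.
(* If x = 0, then its conjugates, which are all the l_i(P), vanish and hence P = 0. *)
apply: contraNneq nzP => x0; rewrite -(map_mx_eq0 (in_alg L)); apply/eqP.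
apply: (conj_coord_inj tau_inj (phi := idfun) (pchar_q := pchar_q)) => i j.
rewrite conj_x; have /rowP/(_ j) := x0; rewrite !mxE => ->.
rewrite -[LHS]/(conj_emb pchar_q idfun i 0) rmorph0 /conj_coord big1 // => k _.
by rewrite mxE mul0r.
Qed.

End BosePlanes.

(** * The three claims over F, L and M *)

Theorem theorem5p7 (q : nat) (F : finFieldType) (L : fieldExtType F)
    (M : fieldExtType L) (tau : L) (t0 t1 t2 : F)
    (Fbar : {mpoly L[3]}) (f0 f1 f2 : {mpoly F[9]})
    (hq : #|F| = q)
    (hL : \dim {:L} = 3%N) (hM : \dim {:M} = 2%N)
    (htau : (q ^ 3 - 1)%N.-primitive_root tau)
    (hmin : minPoly 1%VS tau
            = 'X^3 - t2%:A *: 'X^2 - t1%:A *: 'X - (t0%:A)%:P)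
    (hF : nondegenerate_qform Fbar)
    (hf0 : f0 \is 2.-homog) (hf1 : f1 \is 2.-homog) (hf2 : f2 \is 2.-homog)
    (hf : Fbar \mPo bose_subst tau
          = map_mpoly (in_alg L) f0 + tau *: map_mpoly (in_alg L) f1
            + tau ^+ 2 *: map_mpoly (in_alg L) f2) :
  let extL (f : {mpoly F[9]}) : {mpoly L[9]} := map_mpoly (in_alg L) f in
  let extM (f : {mpoly F[9]}) : {mpoly M[9]} :=
    map_mpoly (in_alg M) (extL f) in
  let A := bose_A tau q in
  let conic := spanned_conic A Fbar in
  let conicM := spanned_conic (fun j => map_mx (in_alg M) (A j))
                              (map_mpoly (in_alg M) Fbar) in
  [/\ forall P : 'rV[F]_9,
        on_bose_planes tau (zero_set Fbar) P
        <-> [/\ zero_set f0 P, zero_set f1 P & zero_set f2 P],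
      forall P : 'rV[L]_9,
        [/\ zero_set (extL f0) P, zero_set (extL f1) P
          & zero_set (extL f2) P]
        <-> on_conjugate_planes q conic P
    & forall P : 'rV[M]_9,
        [/\ zero_set (extM f0) P, zero_set (extM f1) P
          & zero_set (extM f2) P]
        <-> on_conjugate_planes q conicM P].
Proof.
move=> extL extM A conic conicM; case: hF => homF _.
have pchar_q : [pchar F].-nat q by rewrite -hq card_pchar_nat.
have expF (a : F) : a ^+ q = a by rewrite -hq expf_card.
have q_gt1 : (1 < q)%N by rewrite -hq finNzRing_gt1.
have expL (x : L) : x ^+ (q ^ 3) = x by rewrite -hq -hL expf_card_ext.
have expM (x : M) : x ^+ (q ^ 6) = x.
  (* M viewed over F has dimension 2 * 3, hence q^6 elements. *)
  have fullM : baseVspace {:M} = fullv.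
    apply/vspaceP => y; rewrite memvf.
    exact: etrans (mem_baseVspace _ y) (memvf (y : M)).
  have dimM : \dim {:baseFieldType M} = 6%N.
    by rewrite -fullM dim_baseVspace hM hL.
  by have := expf_card_ext (x : baseFieldType M); rewrite dimM hq.
have tau_inj := tau_pow_inj q_gt1 htau.
pose f (e : 'I_3) := [:: f0; f1; f2]`_e.
have hf' : Fbar \mPo bose_subst tau
    = \sum_(e < 3) tau ^+ e *: map_mpoly (in_alg L) (f e).
  by rewrite hf !big_ord_recl big_ord0 addr0 addrA expr0 scale1r expr1.
have root_of_exp (K : fieldType) : (forall x : K, x ^+ (q ^ 6) = x) ->
    forall (i : 'I_3) (y : K), exists x, x ^+ (q ^ i) = y.
  (* The q^(6-i)-th power inverts the q^i-th power when x^(q^6) = x; this holds in M, and in L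
     because 3 divides 6. *)
  move=> expK i y; exists (y ^+ (q ^ (6 - i))).
  by rewrite -exprM -expnD subnK ?expK // ltnW // (leq_trans (ltn_ord i)).
have all3 (p : 'I_3 -> Prop) : (forall e, p e) <-> [/\ p 0, p 1 & p 2].
  split=> [// | [p0 p1 p2] [[|[|[|//]]] e]].
  - by rewrite (_ : Ordinal e = 0) //; apply: val_inj.
  - by rewrite (_ : Ordinal e = 1) //; apply: val_inj.
  - by rewrite (_ : Ordinal e = 2) //; apply: val_inj.
(* A conic point over L; its image in M serves for claim (3). *)
have [v Fv] := zero_set_ternary_ext homF.
have zero3 (K : fieldType) (g : 'I_3 -> {mpoly K[9]}) (P : 'rV[K]_9) :
    [/\ zero_set (g 0) P, zero_set (g 1) P & zero_set (g 2) P]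
    <-> P != 0 /\ forall e, (g e).@[P 0] = 0.
  rewrite (all3 (fun e => (g e).@[P 0] = 0)).
  by split=> [[[nzP ?] [_ ?] [_ ?]] | [nzP [? ? ?]]].
have extE (K : fieldType) (phi : {rmorphism L -> K}) (g : 'I_3 -> {mpoly K[9]})
    (P : 'rV[K]_9) : (forall e, g e = map_mpoly phi (extL (f e))) ->
    [/\ zero_set (g 0) P, zero_set (g 1) P & zero_set (g 2) P]
    <-> P != 0 /\ forall e, mmap (phi \o in_alg L) (P 0) (f e) = 0.
  move=> gE; rewrite zero3.
  by split=> -[nzP g0]; split=> // e; have := g0 e;
    rewrite gE meval_map_mpoly mmap_map_mpoly.
have mapid (n : nat) (p : {mpoly L[n]}) : map_mpoly idfun p = p.
  by apply/mpolyP => m; rewrite mcoeff_map_mpoly.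
split=> P.
- rewrite (bose_planesP pchar_q expF tau_inj hf' homF).
  by rewrite -(zero3 F f).
- rewrite (extE L idfun (fun e => extL (f e))) => [|e]; last by rewrite mapid.
  have expL6 (x : L) : x ^+ (q ^ 6) = x by rewrite (expnD q 3 3) exprM !expL.
  have pointL : exists u, zero_set (map_mpoly idfun Fbar) u.
    by exists v; rewrite mapid.
  have AE j : A j = map_mx idfun (bose_A tau q j) by rewrite map_mx_id.
  have := forms_zeroP pchar_q expF (expL tau) tau_inj hf' homF
    (root_of_exp L expL6) pointL AE P.
  by rewrite mapid.
- rewrite (extE M (in_alg M) (fun e => extM (f e))) //.
  apply: (forms_zeroP pchar_q expF (expL tau) tau_inj hf' homF) => //.
  + exact: root_of_exp.
  + by exists (map_mx (in_alg M) v); apply: zero_set_map.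
Qed.
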